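(* Let $p$ be a prime and $q=1/p$. For integers $n\ge1$, $\mu\ge1$, let $P(n,p^\mu)$ be the probability that a random symmetric $n\times n$ matrix over $\mathbf{Z}_{p^\mu}$ has determinant $\not\equiv 0\pmod{p^\mu}$, and set $P(0,p^\mu)=1$ for $\mu\ge1$. For $n\ge 0$ define the formal power series $\mathcal{P}_n(x)=\sum_{\mu=1}^\infty P(n,p^\mu)x^\mu$. Then for every $k\ge 0$, $$\mathcal{P}_{2k+1}(x)=\Big(\frac{x}{1-x}\Big)\Big(\frac{1-qx^2}{1-qx}\Big)\prod_{j=0}^{k}\Big(\frac{1-q^{2j+1}}{1-q^{2j+1}x^2}\Big)$$ and $$\mathcal{P}_{2k}(x)=\Big(\frac{1-q^{2k+1}x}{1-q^{2k+1}}\Big)\mathcal{P}_{2k+1}(x).$$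
   Context: For a positive integer $m$, $\mathbf{Z}_m=\{1,2,\ldots,m\}$ (viewed as residues mod $m$). A random symmetric $n\times n$ matrix over $\mathbf{Z}_m$ is one whose entries $a_{ij}$, $i\le j$, are chosen independently and uniformly from $\mathbf{Z}_m$, with $a_{ji}=a_{ij}$. *)

(* Defs.v *)
From HB Require Import structures.
From mathcomp Require Import all_boot all_order all_algebra.
Set Implicit Arguments. Unset Strict Implicit. Unset Printing Implicit Defensive.
Import Order.TTheory GRing.Theory Num.Theory.
Local Open Scope ring_scope.

(* Symmetric n x n matrices over 'Z_m (for m >= 2, 'Z_m is Z/mZ). *)
Definition sym_mats (m n : nat) : {set 'M['Z_m]_n} := [set A | A^T == A].

Definition sym_nonsing (m n : nat) : {set 'M['Z_m]_n} :=
  [set A | (A^T == A) && (\det A != 0)].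

(* P(n, m): probability that a uniformly random symmetric n x n matrix over
   Z_m (entries a_ij, i <= j, independent uniform) has det not = 0 mod m.
   Uniform on the upper-triangular entries = uniform on symmetric matrices.
   Convention P(0, m) = 1. *)
Definition Pnm (n m : nat) : rat :=
  if n == 0%N then 1
  else (#|sym_nonsing m n|)%:R / (#|sym_mats m n|)%:R.

Definition fps := nat -> rat.

Definition calP (p n : nat) : fps :=
  fun mu => if mu == 0%N then 0 else Pnm n (p ^ mu).

Definition fps_mul_poly (a : {poly rat}) (s : fps) : fps :=
  fun N => \sum_(i < N.+1) a`_i * s (N - i)%N.

Definition fps_of_poly (a : {poly rat}) : fps := fun N => a`_N.

(* Main.v *)
Require Import Defs.
From HB Require Import structures.
From mathcomp Require Import all_boot all_order all_algebra.
From mathcomp Require Import perm ring zify.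
From Stdlib Require Import FunctionalExtensionality.
Set Implicit Arguments. Unset Strict Implicit. Unset Printing Implicit Defensive.
Import Order.TTheory GRing.Theory Num.Theory.
Local Open Scope ring_scope.

(** Write a symmetric matrix as [[a, b], [b^T, C]]. If a is a unit, the Schur
    complement of a is again uniform, of size n - 1. If a is not a unit but b has
    a unit entry, a congruence turns b into (1, 0, ..., 0) and a 2 x 2 unit block
    splits off. Otherwise a = p a', b = p b', and det = p det [[a', b'], [p b'^T, C]]:
    for a' a unit this is p times a unit times a uniform determinant of size n - 1,
    and for a' = p a'' it is p^2 det [[a'', b'], [b'^T, C]]. Hence
      (1 - q^(n+1) x^2) P_n = (1 - q) (1 + q^n x) P_(n-1) + q (1 - q^(n-1)) P_(n-2),
    and this three-term recurrence has the stated closed form. *)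

(** * Averaging over additive images, block matrices and determinants *)

Lemma sum_additive_image (V W : finZmodType) (f : {additive V -> W})
    (g : W -> rat) :
  #|V|%:R * \sum_(y in codom f) g y = #|codom f|%:R * \sum_x g (f x).
Proof.
(* Every nonempty fibre of [f] is a coset of its kernel, so all have the same size [K]. *)
pose K := #|[set x | f x == 0]|.
have fibre y : y \in codom f -> #|[set x | f x == y]| = K.
  case/codomP=> x0 ->.
  rewrite /K -[RHS](card_imset _ (addrI x0)); apply: eq_card => x; rewrite inE.
  apply/eqP/imsetP => [fx|[z]]; last by rewrite inE => /eqP fz ->; rewrite raddfD fz addr0.
  exists (x - x0); last by rewrite addrC subrK.
  by rewrite inE raddfB fx subrr.
have part (h : W -> rat) :
    \sum_x h (f x) = K%:R * \sum_(y in codom f) h y.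
  rewrite (partition_big f (fun y => y \in codom f)) /=; last first.
    by move=> x _; apply: codom_f.
  rewrite mulr_sumr; apply: eq_bigr => y yf.
  rewrite -(fibre y yf) mulr_natl -sumr_const.
  by apply: eq_big => [x|x /eqP -> //]; rewrite inE.
have -> : #|V|%:R = K%:R * #|codom f|%:R :> rat.
  by have := part (fun=> 1); rewrite !sumr_const.
by rewrite part; ring.
Qed.

Lemma card_rV_in (T : finType) (A : {pred T}) (n : nat) :
  #|[set b : 'rV[T]_n | [forall i, b ord0 i \in A]]| = (#|A| ^ n)%N.
Proof.
rewrite -[n in RHS]card_ord -card_ffun_on.
rewrite -(@card_imset _ _ (fun f : {ffun 'I_n -> T} => \row_i f i)); last first.
  by move=> f g /rowP fg; apply/ffunP => i; have := fg i; rewrite !mxE.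
apply: eq_card => b; rewrite inE; apply/forallP/imsetP => [bA | [f fA ->] i].
  exists [ffun i => b ord0 i]; first by apply/ffun_onP => i; rewrite ffunE.
  by apply/rowP => i; rewrite mxE ffunE.
by rewrite mxE; apply: (ffun_onP fA).
Qed.

Lemma det_schur (R : comUnitRingType) (m n : nat) (K : 'M[R]_m)
    (B : 'M_(m, n)) (B' : 'M_(n, m)) (C : 'M_n) :
  K \in unitmx ->
  \det (block_mx K B B' C) = \det K * \det (C - B' *m invmx K *m B).
Proof.
move=> Ku.
have -> : block_mx K B B' C =
    block_mx 1%:M 0 (B' *m invmx K) 1%:M
    *m block_mx K B 0 (C - B' *m invmx K *m B).
  rewrite mulmx_block !mul1mx !mul0mx !addr0 mulmxKV //.
  by rewrite addrC subrK.
by rewrite det_mulmx det_lblock det_ublock !det1 !mul1r.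
Qed.

(** Swap the unit entry to the front; the swapped row, completed below by [(0, 1)], is upper
    triangular with that unit as determinant. *)
Lemma unimodular_row (R : comUnitRingType) (n : nat) (b : 'rV[R]_(1 + n))
    (i : 'I_(1 + n)) :
  b ord0 i \is a GRing.unit ->
  exists2 V : 'M[R]_(1 + n), V \in unitmx & b = row_mx 1%:M 0 *m V.
Proof.
move=> ui.
pose c := b *m tperm_mx i 0.
pose W := block_mx (lsubmx c) (rsubmx c) 0 1%:M.
have c0 : lsubmx c 0 0 = b 0 i.
  by rewrite mxE /c -xcolE !mxE lshift0 tpermR.
exists (W *m tperm_mx i 0).
  rewrite unitmx_mul unitmx_perm andbT unitmxE det_ublock det1 mulr1.
  by rewrite [lsubmx c]mx11_scalar det_scalar1 c0.
rewrite mulmxA mul_row_block !mul1mx !mul0mx !addr0 hsubmxK /c -mulmxA.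
by rewrite -perm_mxM tperm2 perm_mx1 mulmx1.
Qed.

Lemma sum_sym_block (R : finComNzRingType) (n : nat) (g : 'M[R]_(1 + n) -> rat) :
  \sum_(A | A^T == A) g A =
  \sum_(a : 'M[R]_1) \sum_(b : 'rV[R]_n) \sum_(C : 'M[R]_n | C^T == C)
     g (block_mx a b b^T C).
Proof.
rewrite pair_big pair_big_dep /=.
rewrite (reindex_onto
  (fun x : 'M[R]_1 * 'rV[R]_n * 'M[R]_n => block_mx x.1.1 x.1.2 x.1.2^T x.2)
  (fun A : 'M[R]_(1 + n) => (ulsubmx A, ursubmx A, drsubmx A))) /=; last first.
  move=> A /eqP sA; rewrite -[RHS]submxK; congr block_mx.
  by rewrite trmx_ursub sA.
apply: eq_bigl => -[[a b] C] /=.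
rewrite block_mxKul block_mxKur block_mxKdr eqxx andbT tr_block_mx trmxK.
apply/eqP/eqP => [/eq_block_mx[] //|->].
by rewrite [a]mx11_scalar tr_scalar_mx.
Qed.

(** * The recurrence over a finite local ring with principal maximal ideal *)

Section FiniteChainRing.

Variables (R : finComUnitRingType) (pi : R) (q : rat).
(** The nonunits are exactly the multiples of [pi], so they form the maximal ideal, and [q] is the
    reciprocal of the order of the residue field. *)
Hypothesis nonunit_dvd : forall x : R, x \isn't a GRing.unit -> exists y, x = pi * y.
Hypothesis pi_nonunit : pi \isn't a GRing.unit.
Hypothesis card_nonunit :
  #|[pred x : R | x \isn't a GRing.unit]|%:R = q * #|R|%:R :> rat.

Definition nonunits n (b : 'rV[R]_n) := [forall i, b ord0 i \isn't a GRing.unit].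

Lemma nonunitsP n (b : 'rV[R]_n) :
  reflect (exists b', b = pi *: b') (nonunits b).
Proof.
apply: (iffP forallP) => [bN | [b' ->] i]; last first.
  by rewrite mxE unitrM (negPf pi_nonunit).
have [f fP] := fin_all_exists (fun i => nonunit_dvd (bN i)).
by exists (\row_i f i); apply/rowP => i; rewrite !mxE fP.
Qed.

Lemma card_R_gt0 : 0 < #|R|%:R :> rat.
Proof. by rewrite ltr0n; apply/card_gt0P; exists 0. Qed.

Lemma card_nonunits n : #|@nonunits n|%:R = q ^+ n * #|R|%:R ^+ n :> rat.
Proof.
rewrite -exprMn -card_nonunit -natrX -card_rV_in; congr _%:R.
by apply: eq_card => b; rewrite !inE.
Qed.

Lemma sum_nonunits n (g : 'rV[R]_n -> rat) :
  \sum_(b | nonunits b) g b = q ^+ n * \sum_b g (pi *: b).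
Proof.
have cR : #|{: 'rV[R]_n}|%:R = #|R|%:R ^+ n :> rat by rewrite card_mx mul1n natrX.
have Rn0 : #|R|%:R ^+ n != 0 :> rat by rewrite expf_neq0 ?gt_eqF ?card_R_gt0.
apply: (mulfI Rn0); rewrite mulrA [_ * q ^+ n]mulrC -card_nonunits -cR.
pose f : {additive 'rV[R]_n -> 'rV[R]_n} := *:%R pi.
have codomf : codom f =i @nonunits n.
  by move=> b; apply/codomP/nonunitsP.
rewrite -(eq_card codomf) -[X in _ = _ * X]/(\sum_b g (f b)) -sum_additive_image.
by congr (_ * _); apply: eq_bigl => b; rewrite codomf.
Qed.

Lemma sum_rV_const n (x : rat) : \sum_(b : 'rV[R]_n) x = #|R|%:R ^+ n * x.
Proof. by rewrite sumr_const card_mx mul1n -natrX mulr_natl. Qed.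

Lemma sum_not_nonunits n (x : rat) :
  \sum_(b : 'rV[R]_n | ~~ nonunits b) x = (1 - q ^+ n) * #|R|%:R ^+ n * x.
Proof.
have := sum_rV_const n x; rewrite (bigID (@nonunits n)) /= sum_nonunits.
by rewrite sum_rV_const => /(canRL (addKr _)) ->; ring.
Qed.

(* In Z/pi^M this says that det A is nonzero modulo pi^(M - e), so the moduli
   pi^M, pi^(M - 1), ... are all handled inside one ring, without reduction maps. *)
Definition det_ind n e (A : 'M[R]_n) : rat := (pi ^+ e * \det A != 0)%:R.

Definition nsym n : rat := #|[set A : 'M[R]_n | A^T == A]|%:R.

Definition nsym_det n e : rat := \sum_(A : 'M[R]_n | A^T == A) det_ind e A.

Lemma unit_mul_neq0 (u x y : R) :
  u \is a GRing.unit -> (x * (u * y) != 0) = (x * y != 0).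
Proof.
move=> uu; rewrite mulrCA; congr (~~ _); apply/eqP/eqP => [|->]; last exact: mulr0.
by move/(canRL (mulKr uu)); rewrite mulr0.
Qed.

(** Translation by the symmetric matrix [X] permutes the symmetric [C], and the unit [\det K] does
    not affect vanishing. The factor [c] is 1 for a symmetric block matrix and [pi] once [pi] has
    been pulled out of the top row only. *)
Lemma sum_schur m n e c (K : 'M[R]_m) (B : 'M_(m, n)) :
  K \in unitmx -> K^T = K ->
  \sum_(C : 'M[R]_n | C^T == C) det_ind e (block_mx K B (c *: B^T) C)
    = nsym_det n e.
Proof.
move=> Ku Ks; pose X := c *: B^T *m invmx K *m B.
have Xs : X^T = X.
  by rewrite /X !trmx_mul linearZ /= trmxK trmx_inv Ks -!scalemxAl -!scalemxAr mulmxA.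
rewrite (reindex (fun C => C + X)) /=; last first.
  by exists (fun C => C - X) => C _; rewrite ?addrK ?subrK.
apply: eq_big => [C | C _]; first by rewrite linearD /= Xs (inj_eq (addIr _)).
by rewrite /det_ind det_schur // -/X addrK unit_mul_neq0.
Qed.

Lemma sum_nonunit_unit m e (a : 'M[R]_1) (b : 'rV[R]_(1 + m)) :
  nonunits a -> ~~ nonunits b ->
  \sum_(C : 'M[R]_(1 + m) | C^T == C) det_ind e (block_mx a b b^T C)
    = #|R|%:R ^+ (1 + m) * nsym_det m e.
Proof.
move=> aN; rewrite negb_forall => /existsP[i]; rewrite negbK => ui.
have [V Vu ->] := unimodular_row ui.
have VTu : V^T \in unitmx by rewrite unitmx_tr.
(* Congruence by [V] permutes the symmetric matrices, so the row may be taken to be (1, 0, ...,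
   0). *)
rewrite (reindex (fun C => V^T *m C *m V)) /=; last first.
  exists (fun C => invmx V^T *m C *m invmx V) => C _.
    by rewrite -!mulmxA mulmxV // mulmx1 mulKmx.
  by rewrite -!mulmxA mulVmx // mulmx1 mulKVmx.
transitivity (\sum_(C : 'M[R]_(1 + m) | C^T == C)
    det_ind e (block_mx a (row_mx 1%:M 0) (row_mx 1%:M 0)^T C)).
  apply: eq_big => [C | C _].
    rewrite !trmx_mul trmxK mulmxA; apply/eqP/eqP => [|-> //].
    by move/(can_inj (mulmxK Vu))/(can_inj (mulKmx VTu)).
  set L := row_mx _ _.
  have -> : block_mx a (L *m V) (L *m V)^T (V^T *m C *m V) =
      block_mx 1%:M 0 0 V^T *m block_mx a L L^T C *m block_mx 1%:M 0 0 V.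
    by rewrite !mulmx_block !mul1mx !mul0mx !mulmx0 !mulmx1 !addr0 !add0r trmx_mul.
  rewrite /det_ind !det_mulmx det_lblock det_ublock !det1 !mul1r det_tr.
  by rewrite -mulrA unit_mul_neq0 -?unitmxE // [_ * \det V]mulrC unit_mul_neq0 -?unitmxE.
rewrite sum_sym_block.
transitivity (\sum_(c : 'M[R]_1) \sum_(d : 'rV[R]_m) nsym_det m e).
  apply: eq_bigr => c _; apply: eq_bigr => d _.
  pose K : 'M[R]_(1 + 1) := block_mx a 1%:M 1%:M c.
  have Ku : K \in unitmx.
    (* Swapping the columns of [K] gives [[1, a], [c, 1]], of determinant 1 - ca, a unit because a
       is a multiple of [pi]. *)
    suff: K *m block_mx 0 1%:M 1%:M 0 \in unitmx by rewrite unitmx_mul => /andP[].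
    rewrite mulmx_block !mulmx0 !mulmx1 add0r addr0 add0r addr0.
    rewrite unitmxE det_schur ?unitmx1 // det1 mul1r invmx1 mulmx1 det_mx11.
    have /nonunitsP[a' ->] := aN; rewrite !mxE big_ord1 !mxE /=.
    apply: contraT => /nonunit_dvd[y /(canRL (subrK _)) y1].
    have := unitr1 R; rewrite [X in X \is a _]y1 mulrCA -mulrDr unitrM.
    by rewrite (negPf pi_nonunit).
  have Ks : K^T = K.
    rewrite /K tr_block_mx !trmx1 [a]mx11_scalar [c]mx11_scalar !tr_scalar_mx.
    exact: erefl.
  rewrite -(sum_schur e 1 (col_mx 0 d) Ku Ks); apply: eq_bigr => C _.
  congr det_ind; rewrite scale1r !tr_row_mx tr_col_mx trmx0 trmx1.
  by rewrite block_mxA castmx_id.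
by rewrite !sum_rV_const mulrA expr1 -exprS.
Qed.

Lemma nonunits_unitmx (a : 'M[R]_1) : ~~ nonunits a -> a \in unitmx.
Proof.
rewrite negb_forall => /existsP[i]; rewrite negbK (ord1 i).
by rewrite unitmxE det_mx11.
Qed.

Lemma sym_mx11 (a : 'M[R]_1) : a^T = a.
Proof. by rewrite [a]mx11_scalar tr_scalar_mx. Qed.

Lemma sum_unit_pivot n e c :
  \sum_(a : 'M[R]_1 | ~~ nonunits a) \sum_(b : 'rV[R]_n)
    \sum_(C : 'M[R]_n | C^T == C) det_ind e (block_mx a b (c *: b^T) C)
  = (1 - q) * #|R|%:R ^+ n.+1 * nsym_det n e.
Proof.
transitivity (\sum_(a : 'M[R]_1 | ~~ nonunits a) (#|R|%:R ^+ n * nsym_det n e)).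
  apply: eq_bigr => a /nonunits_unitmx au; rewrite -sum_rV_const.
  by apply: eq_bigr => b _; rewrite sum_schur ?sym_mx11.
by rewrite sum_not_nonunits !expr1 exprS !mulrA.
Qed.

Lemma sum_scaled_row n e :
  \sum_(a : 'M[R]_1) \sum_(b : 'rV[R]_n) \sum_(C : 'M[R]_n | C^T == C)
    det_ind e (block_mx (pi *: a) (pi *: b) (pi *: b)^T C)
  = (1 - q) * #|R|%:R ^+ n.+1 * nsym_det n e.+1 + q * nsym_det n.+1 e.+2.
Proof.
have scale_row (a : 'M[R]_1) (b : 'rV[R]_n) (b' : 'cV[R]_n) C :
    \det (block_mx (pi *: a) (pi *: b) b' C) = pi * \det (block_mx a b b' C).
  have -> : block_mx (pi *: a) (pi *: b) b' C =
      block_mx pi%:M 0 0 1%:M *m block_mx a b b' C.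
    by rewrite mulmx_block !mul0mx !mul1mx !addr0 !add0r !mul_scalar_mx.
  by rewrite det_mulmx det_lblock det1 mulr1 det_scalar1.
rewrite (bigID (@nonunits 1)) /= addrC; congr (_ + _).
  rewrite -(sum_unit_pivot n e.+1 pi).
  apply: eq_bigr => a _; apply: eq_bigr => b _; apply: eq_bigr => C _.
  by rewrite /det_ind scale_row linearZ /= mulrA -exprSr.
rewrite sum_nonunits expr1 -[n.+1]/(1 + n)%N /nsym_det sum_sym_block; congr (_ * _).
apply: eq_bigr => a _; apply: eq_bigr => b _; apply: eq_bigr => C _.
(* The first factor [pi] comes from the top row; transposing makes the first column a top row, which
   yields the second. *)
rewrite /det_ind scale_row -det_tr tr_block_mx trmxK.
rewrite linearZ /= scale_row -det_tr tr_block_mx !trmxK.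
by rewrite !mulrA -!exprSr.
Qed.

(** The three terms are the cases: a unit; a nonunit with a unit in b; all of a, b nonunits, a
    fraction [q ^+ n.+1] of the choices. At n = 0 the junk index [n.-1] is harmless, since its
    coefficient contains 1 - q^0 = 0. *)
Lemma nsym_det_rec n e :
  nsym_det n.+1 e =
    (1 - q) * #|R|%:R ^+ n.+1 * nsym_det n e
    + q * (1 - q ^+ n) * #|R|%:R ^+ (n + n.+1) * nsym_det n.-1 e
    + q ^+ n.+1 * ((1 - q) * #|R|%:R ^+ n.+1 * nsym_det n e.+1
                   + q * nsym_det n.+1 e.+2).
Proof.
rewrite -sum_scaled_row [LHS](sum_sym_block (det_ind e)).
rewrite (bigID (@nonunits 1)) /= addrC -addrA; congr (_ + _).
  rewrite -(sum_unit_pivot n e 1).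
  by apply: eq_bigr => a _; apply: eq_bigr => b _; rewrite scale1r.
under eq_bigr do rewrite (bigID (@nonunits n)) /=.
rewrite big_split /= addrC.
congr (_ + _).
  case: n => [|m].
    rewrite subrr mulr0 !mul0r big1 // => a _; rewrite big1 // => b.
    by case/negP; apply/forallP => -[].
  transitivity (\sum_(a : 'M[R]_1 | nonunits a)
      ((1 - q ^+ m.+1) * #|R|%:R ^+ m.+1 * (#|R|%:R ^+ m.+1 * nsym_det m e))).
    apply: eq_bigr => a aN; rewrite -sum_not_nonunits.
    by apply: eq_bigr => b bN; rewrite sum_nonunit_unit.
  rewrite sum_nonunits sum_rV_const expr1 exprD [_ ^+ m.+2]exprS.
  by ring.
rewrite sum_nonunits expr1 exprS -mulrA; congr (_ * _); rewrite mulr_sumr.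
by apply: eq_bigr => a _; rewrite sum_nonunits.
Qed.

Lemma nsymS n : nsym n.+1 = #|R|%:R ^+ n.+1 * nsym n.
Proof.
have nsymE m : nsym m = \sum_(A : 'M[R]_m | A^T == A) 1.
  by rewrite sumr_const /nsym cardsE.
rewrite [LHS]nsymE [LHS](sum_sym_block (fun=> 1)) -nsymE !sum_rV_const.
by rewrite mulrA -exprD.
Qed.

Lemma nsym_neq0 n : nsym n != 0.
Proof.
by rewrite pnatr_eq0 -lt0n; apply/card_gt0P; exists 0; rewrite inE trmx0.
Qed.

Definition sym_prob n e : rat := nsym_det n e / nsym n.

Lemma sym_prob_rec n e :
  sym_prob n.+1 e =
    (1 - q) * sym_prob n e + q * (1 - q ^+ n) * sym_prob n.-1 e
    + q ^+ n.+1 * ((1 - q) * sym_prob n e.+1 + q * sym_prob n.+1 e.+2).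
Proof.
have R0 : #|R|%:R != 0 :> rat by rewrite gt_eqF ?card_R_gt0.
rewrite /sym_prob {1}nsym_det_rec nsymS.
case: n => [|m].
  by rewrite subrr mulr0 !mul0r; field; rewrite R0 nsym_neq0.
rewrite /= nsymS [in _ ^+ (_ + _)]exprD.
by field; rewrite nsym_neq0 !expf_neq0.
Qed.

End FiniteChainRing.

(** * Specialization to the integers modulo a prime power *)

Section PrimePowerModulus.

Variables (p : nat) (p_prime : prime p).

Let q : rat := p%:R^-1.

Lemma prime_exp_gt1 M : (0 < M)%N -> (1 < p ^ M)%N.
Proof. by move=> M0; rewrite -(exp1n M) ltn_exp2r ?prime_gt1. Qed.

Lemma Zp_natr_eq0 m x : (1 < m)%N -> (x%:R == 0 :> 'Z_m) = (m %| x)%N.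
Proof.
by move=> m1; rewrite -val_eqE /= val_Zp_nat.
Qed.

Lemma Zp_natX_eq0 M e : (0 < M)%N -> (p%:R ^+ e == 0 :> 'Z_(p ^ M)) = (M <= e)%N.
Proof.
move=> M0; rewrite -natrX Zp_natr_eq0 ?prime_exp_gt1 //.
by rewrite dvdn_Pexp2l ?prime_gt1.
Qed.

Lemma Zp_unit_coprime M (x : 'Z_(p ^ M)) : (0 < M)%N ->
  (x \is a GRing.unit) = coprime p x.
Proof.
move=> M0; rewrite -[in LHS](natr_Zp x) unitZpE ?prime_exp_gt1 //.
by rewrite coprime_pexpl.
Qed.

Lemma Zp_nonunit_dvd M (x : 'Z_(p ^ M)) : (0 < M)%N ->
  x \isn't a GRing.unit -> exists y, x = p%:R * y.
Proof.
move=> M0; rewrite Zp_unit_coprime // prime_coprime // negbK => /dvdnP[y xy].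
by exists y%:R; rewrite -natrM mulnC -xy natr_Zp.
Qed.

Lemma Zp_p_nonunit M : (0 < M)%N -> p%:R \isn't a @GRing.unit 'Z_(p ^ M).
Proof.
move=> M0; rewrite unitZpE ?prime_exp_gt1 // coprime_pexpl //.
by rewrite prime_coprime // dvdnn.
Qed.

Lemma card_Zp_nonunit M : (0 < M)%N ->
  #|[pred x : 'Z_(p ^ M) | x \isn't a GRing.unit]|%:R = q * #|'Z_(p ^ M)|%:R :> rat.
Proof.
move=> M0; have m1 := prime_exp_gt1 M0.
have p0 : p%:R != 0 :> rat by rewrite pnatr_eq0 -lt0n prime_gt0.
(* The units number phi(p^M) = (p - 1) p^(M-1), which leaves p^(M-1) nonunits. *)
have cU : #|[pred x : 'Z_(p ^ M) | x \is a GRing.unit]| = (p.-1 * p ^ M.-1)%N.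
  rewrite -totient_pfactor // -card_units_Zp ?(ltnW m1) // /units_Zp cardsT.
  by rewrite card_sub.
have cZ : #|'Z_(p ^ M)| = (p.-1 * p ^ M.-1 + p ^ M.-1)%N.
  rewrite card_ord (Zp_cast m1) -[M in LHS](prednK M0) expnS.
  by rewrite -{1}(prednK (prime_gt0 p_prime)) mulSn addnC.
have -> : #|[pred x : 'Z_(p ^ M) | x \isn't a GRing.unit]| = (p ^ M.-1)%N.
  apply/eqP; rewrite -(eqn_add2l (p.-1 * p ^ M.-1)) -cZ -cU; apply/eqP.
  by rewrite -(cardC [pred x : 'Z_(p ^ M) | x \is a GRing.unit]).
by rewrite cZ -mulSnr (prednK (prime_gt0 p_prime)) natrM mulKf.
Qed.

Definition Zp_prob M n e := @sym_prob 'Z_(p ^ M) p%:R n e.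

Lemma Zp_prob_rec M n e : (0 < M)%N ->
  Zp_prob M n.+1 e =
    (1 - q) * Zp_prob M n e + q * (1 - q ^+ n) * Zp_prob M n.-1 e
    + q ^+ n.+1 * ((1 - q) * Zp_prob M n e.+1 + q * Zp_prob M n.+1 e.+2).
Proof.
move=> M0; apply: sym_prob_rec => [x||]; first exact: Zp_nonunit_dvd.
  exact: Zp_p_nonunit.
exact: card_Zp_nonunit.
Qed.

Lemma Zp_prob_eq0 M n e : (0 < M <= e)%N -> Zp_prob M n e = 0.
Proof.
case/andP=> M0 Me; rewrite /Zp_prob /sym_prob /nsym_det big1 ?mul0r // => A _.
have /eqP pe0 : p%:R ^+ e == 0 :> 'Z_(p ^ M) by rewrite Zp_natX_eq0.
by rewrite /det_ind pe0 mul0r eqxx.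
Qed.

Lemma Zp_prob0 M e : (0 < M)%N -> Zp_prob M 0 e = (e < M)%:R.
Proof.
move=> M0; rewrite /Zp_prob /sym_prob.
have -> : nsym_det (p%:R : 'Z_(p ^ M)) 0 e = (e < M)%:R * nsym 'Z_(p ^ M) 0.
  rewrite /nsym_det /nsym cardsE -sum1_card natr_sum mulr_sumr.
  apply: eq_bigr => A _.
  by rewrite /det_ind det_mx00 mulr1 Zp_natX_eq0 // -ltnNge mulr1.
by rewrite mulfK ?nsym_neq0.
Qed.

(* The recurrence determines [Zp_prob M n e] from [M - e] and [n] alone. *)
Lemma Zp_prob_shift d n M e M' e' : (0 < M)%N -> (0 < M')%N ->
  (M - e = d)%N -> (M' - e' = d)%N -> Zp_prob M n e = Zp_prob M' n e'.
Proof.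
move=> M0 M'0; elim/ltn_ind: n d e e' => n IHn; elim/ltn_ind => d IHd e e' Me M'e'.
have [d0 | d_gt0] := posnP d.
  by rewrite !Zp_prob_eq0 //; apply/andP; split=> //; lia.
case: n IHn IHd => [|n] IHn IHd.
  by rewrite !Zp_prob0 //; congr (nat_of_bool _)%:R; lia.
rewrite (Zp_prob_rec n e) // (Zp_prob_rec n e') //.
rewrite (IHn n _ d e e') // (IHn n.-1 _ d e e') //; last by lia.
rewrite (IHn n _ d.-1 e.+1 e'.+1) //; [|lia|lia].
by rewrite (IHd d.-2 _ e.+2 e'.+2) //; lia.
Qed.

Lemma Pnm_Zp_prob n M : (0 < M)%N -> Pnm n (p ^ M) = Zp_prob M n 0.
Proof.
move=> M0; rewrite /Pnm; case: eqP => [->|_]; first by rewrite Zp_prob0 // M0.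
congr (_ / _); rewrite /nsym_det /sym_nonsing cardsE -sum1_card natr_sum.
rewrite [LHS]big_mkcondr /=; apply: eq_bigr => A _.
by rewrite /det_ind mul1r; case: ifP.
Qed.

(** Truncated subtraction is right here: for e >= M the index is 0, where [calP] vanishes, and so
    does the probability, as p^e = 0. *)
Lemma calP_Zp_prob n M e : (0 < M)%N -> calP p n (M - e)%N = Zp_prob M n e.
Proof.
move=> M0; rewrite /calP; have [Me|Me] := posnP (M - e)%N.
  by rewrite Zp_prob_eq0 // M0 /=; lia.
by rewrite Pnm_Zp_prob //; apply: (@Zp_prob_shift (M - e)); rewrite ?subn0.
Qed.

(** Raising e by 1 or 2 lowers the exponent mu by as much; predecessors that stop at 0 meet the zero
    constant term. *)
Lemma calP_rec n mu :
  calP p n.+1 mu =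
    (1 - q) * calP p n mu + q * (1 - q ^+ n) * calP p n.-1 mu
    + q ^+ n.+1 * ((1 - q) * calP p n mu.-1 + q * calP p n.+1 mu.-2).
Proof.
have [-> | mu0] := posnP mu; first by rewrite /calP /= !(mulr0, addr0).
have calPE m e : calP p m (mu - e)%N = Zp_prob mu m e by apply: calP_Zp_prob.
by have := Zp_prob_rec n 0 mu0; rewrite -!calPE subn0 subn1 subn2.
Qed.

End PrimePowerModulus.

(** * Solving the recurrence for generating functions modulo a power of x *)

Lemma dvdXnP (F : fieldType) (N : nat) (u : {poly F}) :
  reflect (forall i, (i < N)%N -> u`_i = 0) ('X^N %| u).
Proof.
apply: (iffP idP) => [/(Pdiv.IdomainMonic.dvdpP (monicXn F N))[v ->] i iN|u0].
  by rewrite coefMXn iN.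
rewrite -(poly_take_drop N u) dvdp_addl ?dvdp_mull //.
suff -> : take_poly N u = 0 by rewrite dvdp0.
by apply/polyP => i; rewrite coef_take_poly coef0; case: ifP => // /u0.
Qed.

(** This replaces division by a power series with nonzero constant term: such a polynomial is
    coprime to ['X]. *)
Lemma dvdXn_cancel (F : fieldType) (N : nat) (a u : {poly F}) :
  a.[0] != 0 -> 'X^N %| a * u -> 'X^N %| u.
Proof.
by move=> a0; rewrite Gauss_dvdpr // coprimep_expl // coprimep_sym coprimepX.
Qed.

Section GeneratingFunctions.

Variables (p : nat) (p_prime : prime p) (N : nat).

Let q : rat := p%:R^-1.
Let z : {poly rat} := q%:P.
(* Identities between power series are proved modulo 'X^N on these truncations. *)
Let T n : {poly rat} := \poly_(i < N) calP p n i.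

Lemma trunc_rec n :
  'X^N %| (1 - z * z * z ^+ n * 'X^2) * T n.+1
          - ((1 - z) * (1 + z * z ^+ n * 'X) * T n + z * (1 - z ^+ n) * T n.-1).
Proof.
apply/dvdXnP => i iN.
have -> : (1 - z * z * z ^+ n * 'X^2) * T n.+1
    - ((1 - z) * (1 + z * z ^+ n * 'X) * T n + z * (1 - z ^+ n) * T n.-1) =
  T n.+1 - (1 - q)%:P * T n - (q * (1 - q ^+ n))%:P * T n.-1
  - (q ^+ n.+1)%:P * ((1 - q)%:P * (T n * 'X) + z * (T n.+1 * 'X^2)).
  by rewrite [q ^+ n.+1]exprS !(polyCM, polyCB, polyC_exp) -/z polyC1; ring.
rewrite !(coefB, coefD, coefCM, coefMX, coefMXn, coef_poly) iN calP_rec //.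
have [i2 | i2] := ltnP i 2.
  have calP0 m : calP p m 0 = 0 by [].
  by case: i i2 iN => [|[|//]] _ iN; rewrite /= ?(ltnW iN) ?calP0 -/q; ring.
have -> : (i - 2)%N = i.-2 by lia.
have -> : (i == 0)%N = false by lia.
have -> : (i.-1 < N)%N by lia.
have -> : (i.-2 < N)%N by lia.
by rewrite -/q; ring.
Qed.

Lemma horner0_1BMX (c : {poly rat}) k : (1 - c * 'X^(k.+1)).[0] != 0.
Proof. by rewrite !hornerE expr0n /= mulr0 subr0 oner_neq0. Qed.

Lemma even_odd k :
  'X^N %| (1 - z ^+ (2 * k).+1) * T (2 * k)
          - (1 - z ^+ (2 * k).+1 * 'X) * T (2 * k).+1.
Proof.
elim: k => [|k IHk].
  (* At n = 0 the recurrence is (1 - q^2 x^2) P_1 = (1 - q)(1 + qx) P_0; the common factor 1 + qx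
     cancels. *)
  rewrite muln0 expr1; have := trunc_rec 0.
  have -> : forall t1 t0,
    (1 - z * z * z ^+ 0 * 'X^2) * t1
      - ((1 - z) * (1 + z * z ^+ 0 * 'X) * t0 + z * (1 - z ^+ 0) * t0)
    = (1 - (- z) * 'X^1) * ((1 - z * 'X) * t1 - (1 - z) * t0).
    by move=> t1 t0; rewrite expr0 expr1; ring.
  by move/(dvdXn_cancel (horner0_1BMX _ _)); rewrite -dvdpNr opprB.
have rec_even := trunc_rec (2 * k).+1; have rec_odd := trunc_rec (2 * k).+2.
have -> : (2 * k.+1 = (2 * k).+2)%N by lia.
move: IHk rec_even rec_odd; rewrite /= !exprS.
move: (z ^+ (2 * k)) (T (2 * k)) (T (2 * k).+1) (T (2 * k).+2) (T (2 * k).+3).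
move=> w t0 t1 t2 t3 IHk rec_even rec_odd.
(* The induction hypothesis eliminates P_(2k) from the recurrence for P_(2k+2). The result then
   eliminates P_(2k+1) from the recurrence for P_(2k+3), leaving a common factor 1 - q^(2k+4)
   x^2. *)
have {IHk}even : 'X^N %|
    (1 - z * z * z * w * 'X^2) * t2 - (1 - z * z * z * w * 'X) * t1.
  have := dvdp_add rec_even (dvdp_mull z IHk); congr ('X^N %| _); ring.
apply: (@dvdXn_cancel _ _ (1 - (z * z * z * z * w) * 'X^2)).
  exact: horner0_1BMX.
have := dvdp_add (dvdp_mull (- (1 - z * z * z * w * 'X)) rec_odd)
                 (dvdp_mull (z * (1 - z * z * w)) even).
by congr ('X^N %| _); ring.
Qed.

Lemma even_of_odd k :
  'X^N %| (1 - z ^+ (2 * k).+3 * 'X^2) * T (2 * k).+2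
          - (1 - z ^+ (2 * k).+3 * 'X) * T (2 * k).+1.
Proof.
have := dvdp_add (trunc_rec (2 * k).+1) (dvdp_mull z (even_odd k)).
by congr ('X^N %| _); rewrite /= [z ^+ (2 * k).+3]exprS [z ^+ (2 * k).+2]exprS; ring.
Qed.

(** Both [even_of_odd] and [even_odd] at k + 1 involve P_(2k+2); eliminating it leaves a common
    factor 1 - q^(2k+3) x. This ratio is the factor j = k + 1 of the product. *)
Lemma odd_rec k :
  'X^N %| (1 - z ^+ (2 * k).+3 * 'X^2) * T (2 * k).+3
          - (1 - z ^+ (2 * k).+3) * T (2 * k).+1.
Proof.
have := even_odd k.+1; have -> : (2 * k.+1 = (2 * k).+2)%N by lia.
have := even_of_odd k; set w := z ^+ _ => even odd.
apply: (@dvdXn_cancel _ _ (1 - w * 'X^1)); first exact: horner0_1BMX.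
have := dvdp_sub (dvdp_mull (1 - w) even) (dvdp_mull (1 - w * 'X^2) odd).
by congr ('X^N %| _); rewrite expr1; ring.
Qed.

Lemma trunc_calP0 : 'X^N %| (1 - 'X) * T 0 - 'X.
Proof.
apply/dvdXnP => i iN; rewrite mulrBl mul1r !coefB coefXM coefX !coef_poly iN.
case: i iN => [|[|i]] iN; rewrite ?(ltnW iN) /calP /Pnm //=; ring.
Qed.

Lemma calP_odd_closed k :
  'X^N %| (1 - 'X) * (1 - z * 'X)
            * \prod_(j < k.+1) (1 - z ^+ (2 * j).+1 * 'X^2) * T (2 * k).+1
          - 'X * (1 - z * 'X^2) * \prod_(j < k.+1) (1 - z ^+ (2 * j).+1).
Proof.
elim: k => [|k IHk].
  (* For k = 0 the factor 1 - q x^2 occurs on both sides, so the claim is P_1 = x(1 - q)/((1 - x)(1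
     - qx)) multiplied through. *)
  rewrite !big_ord1 muln0 expr1.
  have := even_odd 0; rewrite muln0 expr1 => eo.
  have := dvdp_sub (dvdp_mull ((1 - z * 'X^2) * (1 - z)) trunc_calP0)
                   (dvdp_mull ((1 - 'X) * (1 - z * 'X^2)) eo).
  by congr ('X^N %| _); ring.
rewrite big_ord_recr [\prod_(j < k.+2) (1 - _ ^+ _)]big_ord_recr /=.
have -> : (2 * k.+1 = (2 * k).+2)%N by lia.
move: IHk (odd_rec k); set w := z ^+ _.+3; set A := \prod_(j < _) _.
set B := \prod_(j < _) _ => IHk rec.
have := dvdp_add (dvdp_mull (1 - w) IHk)
                 (dvdp_mull ((1 - 'X) * (1 - z * 'X) * A) rec).
by congr ('X^N %| _); ring.
Qed.

End GeneratingFunctions.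

(** * From truncations back to formal power series *)

Lemma fps_mul_poly_trunc (a : {poly rat}) (s : fps) N :
  fps_mul_poly a s N = (a * \poly_(i < N.+1) s i)`_N.
Proof.
by rewrite coefM; apply: eq_bigr => i _; rewrite coef_poly ltnS leq_subr.
Qed.

Theorem theorem4p2 (p : nat) (hp : prime p) (k : nat) :
  let q : rat := (p%:R)^-1 in
  (* P_{2k+1}(x) = x/(1-x) * (1-qx^2)/(1-qx) * prod_{j=0}^k (1-q^{2j+1})/(1-q^{2j+1}x^2),
     stated with denominators cleared (they are power series with constant term 1). *)
  (fps_mul_poly
     ((1 - 'X) * (1 - q *: 'X) *
        \prod_(j < k.+1) (1 - q ^+ (2 * j).+1 *: 'X^2))
     (calP p (2 * k).+1)
   = fps_of_poly
     ('X * (1 - q *: 'X^2) * \prod_(j < k.+1) (1 - q ^+ (2 * j).+1)%:P))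
  /\
  (* P_{2k}(x) = (1 - q^{2k+1} x)/(1 - q^{2k+1}) * P_{2k+1}(x) *)
  (fps_mul_poly ((1 - q ^+ (2 * k).+1)%:P) (calP p (2 * k))
   = fps_mul_poly (1 - q ^+ (2 * k).+1 *: 'X) (calP p (2 * k).+1)).
Proof.
move=> q.
have qX j m : q ^+ j *: 'X^m = q%:P ^+ j * 'X^m by rewrite -mul_polyC polyC_exp.
have qB j : (1 - q ^+ j)%:P = 1 - q%:P ^+ j by rewrite polyCB polyC_exp.
(* Coefficient [N] depends only on terms up to [N], so the congruences modulo ['X^N.+1] suffice. *)
split; apply: functional_extensionality => N; apply/eqP; rewrite -subr_eq0.
  rewrite fps_mul_poly_trunc /fps_of_poly -coefB; apply/eqP.
  have /dvdXnP := calP_odd_closed hp N.+1 k => /(_ N (ltnSn N)).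
  rewrite !mul_polyC.
  under [\prod_(j < k.+1) (1 - _ * _)]eq_bigr do rewrite -qX.
  by under [\prod_(j < k.+1) (1 - _%:P ^+ _)]eq_bigr do rewrite -qB.
rewrite !fps_mul_poly_trunc -coefB; apply/eqP.
have /dvdXnP := even_odd hp N.+1 k => /(_ N (ltnSn N)).
by rewrite -(qX _ 1%N) -qB.
Qed.
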